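(* If $\beta=\pi/2$, then for every $\theta_c\in[0,\pi]$ there exists no steady state for $(\beta,\theta_c)$.
   Context: **Steady states.** Fix $\beta\in[\pi/2,\pi)$ and $\theta_c\in[0,\pi]$. A steady state for $(\beta,\theta_c)$ consists of three curves $\Gamma_i=\{(r_i(\alpha),z_i(\alpha)):\alpha\in[0,1]\}$, $i=1,2,3$, with $r_i,z_i\in C^2([0,1])$ (subscript $\alpha$ denotes $d/d\alpha$), such that: (a) $0<r_1,r_3<1$ on $[0,1]$; $0<r_2<1$ on $[0,1)$; $z_1,z_3>0$ on $(0,1]$; $z_2>0$ on $[0,1]$. (b) There are numbers $0<r_1^*<r_3^*<1$, $z_2^*>0$, $\bar r\in(0,1)$, $\bar z>0$ with $(r_1,z_1)(0)=(r_1^*,0)$, $(r_1,z_1)(1)=(\bar r,\bar z)$, $(r_2,z_2)(0)=(\bar r,\bar z)$, $(r_2,z_2)(1)=(1,z_2^* )$, $(r_3,z_3)(0)=(r_3^*,0)$, $(r_3,z_3)(1)=(\bar r,\bar z)$. (c) For each $i$, $r_{i\alpha}^2+z_{i\alpha}^2$ is a positive constant. (d) With $H_i=\frac{r_{i\alpha}z_{i\alpha\alpha}-z_{i\alpha}r_{i\alpha\alpha}}{2(r_{i\alpha}^2+z_{i\alpha}^2)^{3/2}}+\frac{z_{i\alpha}}{2r_i\sqrt{r_{i\alpha}^2+z_{i\alpha}^2}}$, there is $\lambda\in\mathbb R$ with $H_1\equiv H_2\equiv\lambda$ and $H_3\equiv0$ on $[0,1]$. (e) There are continuous $\theta_i:[0,1]\to(-\pi,\pi]$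 with $(\cos\theta_i,\sin\theta_i)=(r_{i\alpha},z_{i\alpha})/\sqrt{r_{i\alpha}^2+z_{i\alpha}^2}$, and $\theta_1(0)=\theta_c$, $\theta_2(1)=0$, $\theta_3(0)=\pi/2$, $-\theta_1(1)+\theta_3(1)=\beta$, $\theta_2(0)-\theta_3(1)=-\pi+\beta$. (f) No $\Gamma_i$ self-intersects, and any two distinct curves $\Gamma_i,\Gamma_j$ intersect only at $(\bar r,\bar z)$. *)

(* Defs.v *)
(* Stdlib real numbers throughout. *)
From Stdlib Require Import Reals.
Open Scope R_scope.

Definition I01 (a : R) : Prop := 0 <= a <= 1.

(* Elements of C^2([0,1]), with their first two derivatives.  [D_in] and
   [continue_in] are relative to [I01], so derivatives and continuity are
   one-sided at the endpoints; values outside [0,1] are irrelevant. *)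
Record C2_01 : Type := mkC2_01 {
  fn :> R -> R;
  d1 : R -> R;
  d2 : R -> R;
  d1_deriv : forall a, I01 a -> D_in fn d1 I01 a;
  d2_deriv : forall a, I01 a -> D_in d1 d2 I01 a;
  d2_cont : forall a, I01 a -> continue_in d2 I01 a
}.

Record curve : Type := mkCurve { rc : C2_01; zc : C2_01 }.

Definition point (G : curve) (a : R) : R * R := (rc G a, zc G a).

Definition speed2 (G : curve) (a : R) : R := d1 (rc G) a ^ 2 + d1 (zc G) a ^ 2.

Definition mean_curvature (G : curve) (a : R) : R :=
  (d1 (rc G) a * d2 (zc G) a - d1 (zc G) a * d2 (rc G) a)
    / (2 * Rpower (speed2 G a) (3 / 2))
  + d1 (zc G) a / (2 * rc G a * sqrt (speed2 G a)).

Definition constant_speed (G : curve) : Prop :=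
  exists c : R, 0 < c /\ forall a, I01 a -> speed2 G a = c.

Definition tangent_angle (G : curve) (theta : R -> R) : Prop :=
  (forall a, I01 a -> continue_in theta I01 a) /\
  (forall a, I01 a ->
     - PI < theta a <= PI /\
     cos (theta a) = d1 (rc G) a / sqrt (speed2 G a) /\
     sin (theta a) = d1 (zc G) a / sqrt (speed2 G a)).

Definition simple_curve (G : curve) : Prop :=
  forall s t, I01 s -> I01 t -> point G s = point G t -> s = t.

Definition meet_only_at (G G' : curve) (p : R * R) : Prop :=
  forall s t, I01 s -> I01 t -> point G s = point G' t -> point G s = p.

Inductive index : Set := i1 | i2 | i3.

Definition is_steady_state (beta theta_c : R) (Gamma : index -> curve) : Prop :=
  let r i := rc (Gamma i) in
  let z i := zc (Gamma i) in
  (forall a, 0 <= a <= 1 -> 0 < r i1 a < 1 /\ 0 < r i3 a < 1) /\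
  (forall a, 0 <= a < 1 -> 0 < r i2 a < 1) /\
  (forall a, 0 < a <= 1 -> 0 < z i1 a /\ 0 < z i3 a) /\
  (forall a, 0 <= a <= 1 -> 0 < z i2 a) /\
  (forall i, constant_speed (Gamma i)) /\
  (exists lambda : R, forall a, I01 a ->
     mean_curvature (Gamma i1) a = lambda /\
     mean_curvature (Gamma i2) a = lambda /\
     mean_curvature (Gamma i3) a = 0) /\
  (exists theta : index -> R -> R,
     (forall i, tangent_angle (Gamma i) (theta i)) /\
     theta i1 0 = theta_c /\
     theta i2 1 = 0 /\
     theta i3 0 = PI / 2 /\
     - theta i1 1 + theta i3 1 = beta /\
     theta i2 0 - theta i3 1 = - PI + beta) /\
  (forall i, simple_curve (Gamma i)) /\
  (exists r1s r3s z2s rbar zbar : R,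
     (0 < r1s /\ r1s < r3s /\ r3s < 1) /\
     0 < z2s /\ 0 < rbar < 1 /\ 0 < zbar /\
     point (Gamma i1) 0 = (r1s, 0) /\ point (Gamma i1) 1 = (rbar, zbar) /\
     point (Gamma i2) 0 = (rbar, zbar) /\ point (Gamma i2) 1 = (1, z2s) /\
     point (Gamma i3) 0 = (r3s, 0) /\ point (Gamma i3) 1 = (rbar, zbar) /\
     (forall i j, i <> j -> meet_only_at (Gamma i) (Gamma j) (rbar, zbar))).

(* Main.v *)
From Stdlib Require Import Reals Lra.
Require Import Defs.
Open Scope R_scope.

(** Write [theta] for the tangent angle and [H] for the mean curvature of a
    generating curve.  A constant [H] has the first integral (force balance)
    [r sin theta - H r^2], because [(r sin theta)_s = 2 H r cos theta] in
    arc length [s].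

    The curve [i3] is minimal, so [r r_alpha] has the positive constant
    [r_alpha^2 + z_alpha^2] as derivative; it vanishes at the vertical start,
    hence [k = cos (theta_3 1)] is positive.  When [beta = PI/2], both other
    curves have angle [theta_3 1 - PI/2] at the junction, whose sine is [- k]:
    they continue each other smoothly and, having the same curvature [lambda],
    share one value of the first integral.  That value is [- lambda], read off
    at the right end of [i2], where [r = 1] and [theta = 0].  At the junction
    this says [lambda (1 - rbar^2) = rbar k], so [lambda > 0].  Along [i1] it
    says [r sin theta = lambda (r^2 - 1) < 0]: the curve descends all the way.
    But it leads from height [0] up to height [zbar > 0], a contradiction.

    The first integral is [force_balance], the positivity of [k] rests on
    [minimal_r_dr_increment], and both need the mean value theorem for
    one-sided derivatives on [[0,1]], [mvt_I01]. *)

(** * One-sided calculus on the unit interval *)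

(** Composing with [clamp] turns continuity relative to [I01] into continuity
    on the whole line, as the mean value theorem wants it at the endpoints. *)
Definition clamp (x : R) : R := Rmax 0 (Rmin 1 x).

Lemma clamp_I01 x : I01 (clamp x).
Proof. unfold I01, clamp, Rmax, Rmin; repeat destruct Rle_dec; lra. Qed.

Lemma clamp_id x : I01 x -> clamp x = x.
Proof. unfold I01, clamp, Rmax, Rmin; intros; repeat destruct Rle_dec; lra. Qed.

Lemma clamp_lipschitz x y : Rabs (clamp x - clamp y) <= Rabs (x - y).
Proof.
  unfold clamp, Rmax, Rmin, Rabs; repeat destruct Rle_dec;
    repeat destruct Rcase_abs; lra.
Qed.

Lemma continuity_pt_clamp f x :
  continue_in f I01 (clamp x) -> continuity_pt (fun y => f (clamp y)) x.
Proof.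
  intros hf eps heps.
  destruct (hf eps heps) as [del [hdel H]].
  exists del; split; [exact hdel|].
  intros y [_ hy]; simpl in *; unfold Rdist in *.
  destruct (Req_dec (clamp y) (clamp x)) as [e|ne].
  - rewrite e, Rminus_diag, Rabs_R0; exact heps.
  - apply H; split.
    + split; [apply clamp_I01 | auto].
    + eapply Rle_lt_trans; [apply clamp_lipschitz | exact hy].
Qed.

Lemma derivable_pt_lim_clamp f d x :
  0 < x < 1 -> D_in f d I01 x ->
  derivable_pt_lim (fun y => f (clamp y)) x (d x).
Proof.
  intros hx hf.
  apply derivable_pt_lim_D_in; intros eps heps.
  destruct (hf eps heps) as [del [hdel H]].
  exists (Rmin del (Rmin x (1 - x))); split.
  - apply Rmin_pos; [exact hdel | apply Rmin_pos; lra].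
  - intros y [[_ ne] hy]; simpl in *; unfold Rdist in *.
    assert (h1 := Rmin_l del (Rmin x (1 - x))).
    assert (h2 := Rmin_r del (Rmin x (1 - x))).
    assert (h3 := Rmin_l x (1 - x)).
    assert (h4 := Rmin_r x (1 - x)).
    assert (hyI : I01 y) by
      (unfold I01; revert hy; unfold Rabs; destruct Rcase_abs; lra).
    rewrite (clamp_id y hyI), (clamp_id x) by (unfold I01; lra).
    apply H; split; [split; [exact hyI | auto] | lra].
Qed.

Lemma mvt_I01 f d a b :
  (forall x, I01 x -> D_in f d I01 x) -> 0 <= a -> a < b -> b <= 1 ->
  exists c, a < c < b /\ f b - f a = d c * (b - a).
Proof.
  intros hf ha hab hb.
  set (g := fun y => f (clamp y)).
  assert (hg : forall c, a < c < b -> derivable_pt_lim g c (d c)).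
  { intros c hc; apply derivable_pt_lim_clamp; [lra | apply hf; unfold I01; lra]. }
  destruct (MVT g id a b (fun c hc => exist _ (d c) (hg c hc))
              (fun c _ => derivable_pt_id c) hab) as [c [hc E]].
  - intros c hc; apply continuity_pt_clamp, cont_deriv with d.
    apply hf, clamp_I01.
  - intros c hc; apply derivable_continuous_pt, derivable_pt_id.
  - exists c; split; [exact hc|].
    rewrite derive_pt_id in E; simpl in E; unfold g, id in E.
    rewrite !clamp_id in E by (unfold I01; lra); lra.
Qed.

Lemma adherent_I01 x : I01 x -> adhDa (D_x I01 x) x.
Proof.
  intros hx e he; unfold I01 in hx.
  set (m := Rmin e 1 / 2).
  assert (hm : 0 < m /\ m < e /\ m <= 1 / 2).
  { unfold m; generalize (Rmin_l e 1) (Rmin_r e 1) (Rmin_pos e 1 he Rlt_0_1); lra. }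
  destruct (Rle_dec x (1 / 2)).
  - exists (x + m); repeat split; try lra.
    unfold Rdist; replace (x + m - x) with m by ring; rewrite Rabs_pos_eq; lra.
  - exists (x - m); repeat split; try lra.
    unfold Rdist; replace (x - m - x) with (- m) by ring.
    rewrite Rabs_Ropp, Rabs_pos_eq; lra.
Qed.

Lemma D_in_constant_on f d k x :
  (forall y, I01 y -> f y = k) -> I01 x -> D_in f d I01 x -> d x = 0.
Proof.
  intros hk hx hf.
  apply (single_limit _ _ _ _ _ (adherent_I01 x hx) hf).
  apply limit1_ext with (fun y => (k - k) / (y - x)).
  - intros y [hy _]; rewrite (hk x hx), (hk y hy); reflexivity.
  - exact (Dconst I01 k x).
Qed.

Lemma D_in_sqr f d D x :
  D_in f d D x -> D_in (fun y => f y ^ 2) (fun y => 2 * f y * d y) D x.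
Proof.
  intros hf eps heps; destruct (Dmult _ _ _ _ _ _ hf hf eps heps) as [del [h0 H]].
  exists del; split; [exact h0|]; intros y hy; simpl in *.
  rewrite !Rmult_1_r.
  replace (2 * f x * d x) with (d x * f x + f x * d x) by ring.
  now apply H.
Qed.

(** * Curves of constant speed and constant mean curvature *)

Lemma speed_acceleration_orthogonal G c a :
  (forall x, I01 x -> speed2 G x = c) -> I01 a ->
  d1 (rc G) a * d2 (rc G) a + d1 (zc G) a * d2 (zc G) a = 0.
Proof.
  intros hc ha.
  assert (hr := d2_deriv (rc G) a ha).
  assert (hz := d2_deriv (zc G) a ha).
  assert (E := D_in_constant_on _ _ c a hc ha
    (Dadd _ _ _ _ _ _ (D_in_sqr _ _ _ _ hr) (D_in_sqr _ _ _ _ hz))).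
  simpl in E; lra.
Qed.

Lemma Rpower_three_halves c : 0 < c -> Rpower c (3 / 2) = c * sqrt c.
Proof.
  intros hc; replace (3 / 2) with (1 + / 2) by lra.
  now rewrite Rpower_plus, Rpower_1, Rpower_sqrt.
Qed.

(** At constant speed the acceleration is normal to the curve, so the curvature
    determines it: these are the equations for [z''] and [r'']. *)
Lemma curvature_equations G c H a :
  0 < c -> (forall x, I01 x -> speed2 G x = c) -> I01 a ->
  0 < rc G a -> mean_curvature G a = H ->
  d1 (rc G) a * d1 (zc G) a + rc G a * d2 (zc G) a
    = 2 * H * sqrt c * rc G a * d1 (rc G) a /\
  d1 (zc G) a ^ 2 - rc G a * d2 (rc G) a
    = 2 * H * sqrt c * rc G a * d1 (zc G) a.
Proof.
  intros hc hs ha hr hH.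
  assert (ho := speed_acceleration_orthogonal G c a hs ha).
  assert (hsp := hs a ha).
  unfold mean_curvature in hH; rewrite hsp in hH.
  rewrite Rpower_three_halves in hH by exact hc.
  assert (hq : 0 < sqrt c) by now apply sqrt_lt_R0.
  unfold speed2 in hsp.
  set (r := rc G a) in *; set (p := d1 (rc G) a) in *; set (q := d1 (zc G) a) in *.
  set (p' := d2 (rc G) a) in *; set (q' := d2 (zc G) a) in *; set (s := sqrt c) in *.
  assert (E : r * (p * q' - q * p') + c * q = 2 * H * r * c * s).
  { rewrite <- hH; field; repeat split; lra. }
  assert (Ez : p * (p * q' - q * p') = c * q').
  { rewrite <- hsp.
    replace (p * (p * q' - q * p'))
      with ((p ^ 2 + q ^ 2) * q' - q * (p * p' + q * q')) by ring.
    rewrite ho; ring. }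
  assert (Er : q * (p * q' - q * p') = - c * p').
  { rewrite <- hsp.
    replace (q * (p * q' - q * p'))
      with (- (p ^ 2 + q ^ 2) * p' + p * (p * p' + q * q')) by ring.
    rewrite ho; ring. }
  split; apply Rmult_eq_reg_l with c; try lra.
  - replace (c * (p * q + r * q')) with (r * (c * q') + p * (c * q)) by ring.
    rewrite <- Ez.
    replace (r * (p * (p * q' - q * p')) + p * (c * q))
      with (p * (r * (p * q' - q * p') + c * q)) by ring.
    rewrite E; ring.
  - replace (c * (q ^ 2 - r * p')) with (r * (- c * p') + q * (c * q)) by ring.
    rewrite <- Er.
    replace (r * (q * (p * q' - q * p')) + q * (c * q))
      with (q * (r * (p * q' - q * p') + c * q)) by ring.
    rewrite E; ring.
Qed.

(** The first integral, multiplied by the speed [sqrt c] to avoid quotients.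
    Its derivative vanishes by the equation for [z'']. *)
Lemma force_balance G c H a :
  0 < c -> (forall x, I01 x -> speed2 G x = c) ->
  (forall x, I01 x -> 0 < rc G x) ->
  (forall x, I01 x -> mean_curvature G x = H) -> I01 a ->
  rc G a * d1 (zc G) a - H * sqrt c * rc G a ^ 2
    = rc G 1 * d1 (zc G) 1 - H * sqrt c * rc G 1 ^ 2.
Proof.
  intros hc hs hr hH ha.
  destruct (Req_dec a 1) as [->|ne]; [reflexivity|].
  assert (hD := fun x (hx : I01 x) =>
    Dminus I01 _ _ _ _ x
      (Dmult I01 _ _ _ _ x (d1_deriv (rc G) x hx) (d2_deriv (zc G) x hx))
      (Dmult_const I01 _ _ x (H * sqrt c)
         (D_in_sqr _ _ _ _ (d1_deriv (rc G) x hx)))).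
  unfold I01 in ha.
  destruct (mvt_I01 _ _ a 1 hD) as [x [hx E]]; try lra.
  assert (hxI : I01 x) by (unfold I01; lra).
  destruct (curvature_equations G c H x hc hs hxI (hr x hxI) (hH x hxI)) as [Ez _].
  cbv beta in E; simpl in E.
  match type of E with _ = ?d * _ => assert (d0 : d = 0) by lra end.
  rewrite d0 in E; simpl; lra.
Qed.

(** On a minimal curve the equation for [r''] reads [r r'' = z'^2], so
    [(r r')' = r'^2 + z'^2] is constant. *)
Lemma minimal_r_dr_increment G c :
  0 < c -> (forall x, I01 x -> speed2 G x = c) ->
  (forall x, I01 x -> 0 < rc G x) ->
  (forall x, I01 x -> mean_curvature G x = 0) ->
  rc G 1 * d1 (rc G) 1 - rc G 0 * d1 (rc G) 0 = c.
Proof.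
  intros hc hs hr hH.
  assert (hD := fun x (hx : I01 x) =>
    Dmult I01 _ _ _ _ x (d1_deriv (rc G) x hx) (d2_deriv (rc G) x hx)).
  destruct (mvt_I01 _ _ 0 1 hD) as [x [hx E]]; try lra.
  assert (hxI : I01 x) by (unfold I01; lra).
  destruct (curvature_equations G c 0 x hc hs hxI (hr x hxI) (hH x hxI)) as [_ Er].
  assert (hsp := hs x hxI); unfold speed2 in hsp.
  cbv beta in E; lra.
Qed.

(** * Nonexistence *)

Lemma tangent_components G theta c a :
  tangent_angle G theta -> 0 < c -> (forall x, I01 x -> speed2 G x = c) -> I01 a ->
  d1 (rc G) a = sqrt c * cos (theta a) /\ d1 (zc G) a = sqrt c * sin (theta a).
Proof.
  intros [_ ht] hc hs ha.
  destruct (ht a ha) as [_ [-> ->]].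
  rewrite (hs a ha).
  assert (0 < sqrt c) by now apply sqrt_lt_R0.
  split; field; lra.
Qed.

Theorem lemma4p7 (beta : R) (hbeta : PI / 2 <= beta < PI) :
  beta = PI / 2 ->
  forall theta_c : R, 0 <= theta_c <= PI ->
  ~ exists Gamma : index -> curve, is_steady_state beta theta_c Gamma.
Proof.
  intros hb theta_c _ [Gamma
    [hr13 [hr2 [_ [_ [hspeed [[lam hH] [[theta [hth [_ [t2 [t3 [j1 j2]]]]]]
    [_ [r1s [r3s [z2s [rb [zb [_ [_ [hrb [hzb [p10 [p11 [p20 [p21 [_ [p31 _]]]]]]]]]]]]]]]]]]]]]]]].
  unfold point in *.
  injection p10 as _ z10. injection p11 as r11 z11. injection p20 as r20 _.
  injection p21 as r21 _. injection p31 as r31 _.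
  destruct (hspeed i1) as [c1 [c1pos s1]].
  destruct (hspeed i2) as [c2 [c2pos s2]].
  destruct (hspeed i3) as [c3 [c3pos s3]].
  assert (q1 : 0 < sqrt c1) by now apply sqrt_lt_R0.
  assert (q2 : 0 < sqrt c2) by now apply sqrt_lt_R0.
  assert (q3 : 0 < sqrt c3) by now apply sqrt_lt_R0.
  assert (I0 : I01 0) by (unfold I01; lra).
  assert (I1 : I01 1) by (unfold I01; lra).
  assert (r1pos : forall x, I01 x -> 0 < rc (Gamma i1) x) by apply hr13.
  assert (r3pos : forall x, I01 x -> 0 < rc (Gamma i3) x) by apply hr13.
  assert (r2pos : forall x, I01 x -> 0 < rc (Gamma i2) x).
  { intros x [h0 [h1| ->]]; [apply hr2; lra | rewrite r21; lra]. }
  set (k := cos (theta i3 1)).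
  assert (kpos : 0 < k).
  { destruct (tangent_components _ _ c3 0 (hth i3) c3pos s3 I0) as [e0 _].
    destruct (tangent_components _ _ c3 1 (hth i3) c3pos s3 I1) as [e1 _].
    rewrite t3, cos_PI2, Rmult_0_r in e0.
    assert (E := minimal_r_dr_increment _ c3 c3pos s3 r3pos
                   (fun x hx => proj2 (proj2 (hH x hx)))).
    rewrite e0, e1, r31 in E; fold k in E.
    apply Rmult_lt_reg_l with (rb * sqrt c3); [apply Rmult_lt_0_compat; lra | lra]. }
  assert (junction : sin (theta i3 1 - PI / 2) = - k).
  { rewrite sin_minus, sin_PI2, cos_PI2; unfold k; ring. }
  assert (dz1 : d1 (zc (Gamma i1)) 1 = - (sqrt c1 * k)).
  { destruct (tangent_components _ _ c1 1 (hth i1) c1pos s1 I1) as [_ ->].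
    replace (theta i1 1) with (theta i3 1 - PI / 2) by lra.
    rewrite junction; ring. }
  assert (dz2 : d1 (zc (Gamma i2)) 0 = - (sqrt c2 * k)).
  { destruct (tangent_components _ _ c2 0 (hth i2) c2pos s2 I0) as [_ ->].
    replace (theta i2 0) with (theta i3 1 - PI / 2) by lra.
    rewrite junction; ring. }
  assert (lam_eq : lam * (1 - rb ^ 2) = rb * k).
  { assert (E := force_balance _ c2 lam 0 c2pos s2 r2pos
                   (fun x hx => proj1 (proj2 (hH x hx))) I0).
    destruct (tangent_components _ _ c2 1 (hth i2) c2pos s2 I1) as [_ e1].
    rewrite t2, sin_0, Rmult_0_r in e1.
    rewrite dz2, e1, r20, r21 in E.
    apply Rmult_eq_reg_l with (sqrt c2); lra. }
  assert (lampos : 0 < lam).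
  { apply Rmult_lt_reg_r with (1 - rb ^ 2); [nra|].
    rewrite Rmult_0_l, lam_eq; apply Rmult_lt_0_compat; lra. }
  destruct (mvt_I01 _ _ 0 1 (d1_deriv (zc (Gamma i1)))) as [x [hx climb]]; try lra.
  rewrite z10, z11 in climb.
  assert (hxI : I01 x) by (unfold I01; lra).
  assert (E := force_balance _ c1 lam x c1pos s1 r1pos
                 (fun y hy => proj1 (hH y hy)) hxI).
  rewrite dz1, r11 in E.
  destruct (hr13 x hxI) as [hr1 _].
  set (r := rc (Gamma i1) x) in *.
  set (v := d1 (zc (Gamma i1)) x) in *.
  assert (descent : r * v = - (lam * sqrt c1 * (1 - r ^ 2))).
  { replace (rb * - (sqrt c1 * k)) with (- sqrt c1 * (rb * k)) in E by ring.
    rewrite <- lam_eq in E; lra. }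
  assert (0 < r * v) by (apply Rmult_lt_0_compat; lra).
  assert (0 < lam * sqrt c1 * (1 - r ^ 2)).
  { apply Rmult_lt_0_compat; [now apply Rmult_lt_0_compat | nra]. }
  lra.
Qed.
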